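(* Let $l,w\ge2$ be integers and let $t\in\{1,2\}$. Let $h(p)=\sum_{k=l}^{wl}N_kp^k(1-p)^{wl-k}=\sum_{k=l}^{wl}P_kp^k$ be the reliability polynomial of the hammock network of length $l$, width $w$ and type $t$. Then its first coefficient is $$P_l=N_l=\mathcal B^{(t)}_{l,w},$$ the number of brick-wall lattice paths of type $t$ connecting the left and right sides of the rectangle $[0,l-1]\times[0,w-1]$.
   Context: Hammock network of length $l$, width $w$ and type $t$: it has $wl$ two-contact relays $c_{i,j}$, $0\le i\le l-1$, $0\le j\le w-1$, each joining a left end to a right end. All left ends of the relays $c_{0,j}$ are identified with the source $S$, and all right ends of the relays $c_{l-1,j}$ with the terminus $T$. For $1\le i\le l-1$ the right end of $c_{i-1,j}$ and the left end of $c_{i,j}$ are identified to a node $(i,j)$; and the nodes $(i,j)$ and $(i,j+1)$ ($0\le j\le w-2$) are moreover joined by a (perfect) wire, i.e. identified, exactly when $i+j$ is even for type $t=1$, and exactly when $i+j$ is odd for type $t=2$. Each relay is independently closed with probability $p$ and open with probability $1-p$; the network is closed if $S$ and $T$ are connected through closed relays (regarded as undirected edges). The reliability polynomial $h(p)$ is the probability that the network is closed. $N_k$ is the number of $k$-element subsets of relays such that the network is closed when exactly these relays are closed, and $P_k$ is the coefficient of $p^k$ in $h(p)$. A point $(a,b)\in\mathbf Z\times\mathbf Z$ is even (odd) if $|a|+|b|$ is even (odd). A brick-wall lattice path of type 1 (first type) is a finite sequence of points of $\mathbf Z\times\mathbf Z$ in which each consecutive step is either $(1,0)$ (from any point), or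 $(0,1)$ from an even point, or $(0,-1)$ from an odd point. Type 2 (second type) is defined in the same way with steps $(1,0)$ from any point, $(0,1)$ from an odd point, $(0,-1)$ from an even point. Paths visit no point more than once. $\mathcal B^{(t)}_{l,w}$ is the number of brick-wall lattice paths of type $t$ starting at some point $(0,\alpha)$ and ending at some point $(l-1,\beta)$, with $\alpha,\beta\in\{0,\dots,w-1\}$, staying inside $[0,l-1]\times[0,w-1]$ and using no vertical step along the left side $x=0$ (vertical steps along the right side $x=l-1$ are allowed). *)

(* Defs.v *)
From HB Require Import structures.
From mathcomp Require Import all_boot all_order all_algebra.
From mathcomp Require Import finmap classical_sets cardinality.

Set Implicit Arguments.
Unset Strict Implicit.
Unset Printing Implicit Defensive.

Import Order.TTheory GRing.Theory Num.Theory.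

Local Open Scope ring_scope.

Inductive kind := Type1 | Type2.

(* Parity of the sum of coordinates from which one goes up; the points of the
   other parity are those from which one goes down. *)
Definition up_parity (t : kind) (n : nat) : bool :=
  match t with Type1 => ~~ odd n | Type2 => odd n end.

Definition relay (l w : nat) := ('I_l * 'I_w)%type.

(* Vertices of the network before the wires are contracted: [inl false] is S,
   [inl true] is T and [inr (i, j)] is the node (i, j).  The vertices
   [inr (0, j)] are not part of the network; they are left isolated. *)
Definition vertex (l w : nat) := (bool + 'I_l * 'I_w)%type.

Definition source (l w : nat) : vertex l w := inl false.
Definition terminus (l w : nat) : vertex l w := inl true.

Definition left_end (l w : nat) (c : relay l w) : vertex l w :=
  if c.1 == 0%N :> nat then source l w else inr c.

(* [insub i.+1] is [None] exactly when i = l - 1. *)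
Definition right_end (l w : nat) (c : relay l w) : vertex l w :=
  if insub (c.1).+1 is Some i then inr (i, c.2) else terminus l w.

Definition wire (t : kind) (l w : nat) (u v : vertex l w) : bool :=
  match u, v with
  | inr (i, j), inr (i', j') =>
      [&& (1 <= i)%N, i' == i, j' == j.+1 :> nat & up_parity t (i + j)%N]
  | _, _ => false
  end.

(* A perfect wire conducts in every configuration, so that contracting it and
   keeping it as a permanent edge connect the same vertices. *)
Definition conducts (t : kind) (l w : nat) (A : {set relay l w}) :
    rel (vertex l w) := fun u v =>
  [|| wire t u v, wire t v u
    | [exists c in A, ((u == left_end c) && (v == right_end c))
                   || ((v == left_end c) && (u == right_end c))]].

(* The network is closed when the closed relays are exactly those in A. *)
Definition network_closed (t : kind) (l w : nat) (A : {set relay l w}) : bool :=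
  connect (conducts t A) (source l w) (terminus l w).

(* Probability that the network is closed, the configuration of the relays
   following the product of Bernoulli laws of parameter p.  The ring is
   arbitrary so that p may also be an indeterminate. *)
Definition closed_prob (R : comNzRingType) (t : kind) (l w : nat) (p : R) : R :=
  \sum_(A : {set relay l w} | network_closed t A)
     \prod_(c : relay l w) (if c \in A then p else 1 - p).

Definition reliability_poly (R : comNzRingType) (t : kind) (l w : nat) :
    {poly R} :=
  closed_prob t l w 'X.

Definition closed_count (t : kind) (l w k : nat) : nat :=
  #|[set A : {set relay l w} | (#|A| == k) && network_closed t A]|.

Definition zpoint := (int * int)%type.

Definition bw_step (t : kind) : rel zpoint := fun x y =>
  [|| y == (x.1 + 1, x.2),
      up_parity t (absz x.1 + absz x.2)%N && (y == (x.1, x.2 + 1))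
    | ~~ up_parity t (absz x.1 + absz x.2)%N && (y == (x.1, x.2 - 1))].

Definition bw_path (t : kind) (s : seq zpoint) : bool :=
  [&& s != [::], sorted (bw_step t) s & uniq s].

Definition in_rectangle (l w : nat) (x : zpoint) : bool :=
  (0 <= x.1 <= l%:Z - 1) && (0 <= x.2 <= w%:Z - 1).

Definition no_left_vertical (s : seq zpoint) : bool :=
  sorted (fun x y : zpoint => ~~ ((x.1 == 0) && (y.1 == 0))) s.

(* For points of the rectangle, the ordinates of the two ends automatically
   lie in {0, ..., w - 1}. *)
Definition crossing_paths (t : kind) (l w : nat) : set (seq zpoint) :=
  [set s | [&& bw_path t s, all (in_rectangle l w) s, no_left_vertical s,
               (head (0, 0) s).1 == 0 & (last (0, 0) s).1 == l%:Z - 1]]%classic.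

(* [fset_set] is only meaningful on finite sets. *)
Definition bw_count (t : kind) (l w : nat) : nat :=
  #|` fset_set (crossing_paths t l w)|%fset.

(* Main.v *)
(** A closed network contains a relay in every column, since otherwise the
vertices up to the empty column form a cut. A closed set of l relays is
therefore a graph j = f(i) with one relay per column, and by a similar cut it
conducts exactly when, for k >= 1, the nodes (k, f(k-1)) and (k, f k) coincide.
A crossing brick-wall path makes at most one vertical step in each column, so
it is determined by the height f k at which it leaves column k, and these
heights satisfy the same condition, with no step in column 0. *)

Require Import Defs.
From mathcomp Require Import all_boot all_order all_algebra zify.
From mathcomp Require Import finmap classical_sets cardinality.
Import Order.TTheory GRing.Theory Num.Theory.
Local Open Scope ring_scope.

Set Implicit Arguments.
Unset Strict Implicit.
Unset Printing Implicit Defensive.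

(** * Blocks of wired nodes *)

(* Wires group the nodes (k, j) of column k in consecutive pairs; [block t k j]
   numbers the pair containing (k, j). *)
Definition block (t : kind) (k j : nat) : nat :=
  ((j + ~~ up_parity t k)./2)%N.

Lemma block_wire t k j : up_parity t (k + j) -> block t k j = block t k j.+1.
Proof. by rewrite /block; case: t => /=; lia. Qed.

Lemma block_eqP t k a b : reflect
  [\/ a = b, b = a.+1 /\ up_parity t (k + a) | a = b.+1 /\ up_parity t (k + b)]
  (block t k a == block t k b).
Proof.
apply: (iffP eqP) => [|[-> //|[-> /block_wire-> //]|[-> /block_wire-> //]]].
rewrite /block => e.
have : a = b \/ (b = a.+1 /\ up_parity t (k + a))
        \/ (a = b.+1 /\ up_parity t (k + b)) by case: t e => /=; lia.
by case=> [|[|]] ?; [apply: Or31|apply: Or32|apply: Or33].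
Qed.

(** A block has at most two elements; this is what rules out a second vertical step in a column. *)
Lemma block_pair t k a b c : block t k a = block t k c ->
  block t k b = block t k c -> a <> c -> b <> c -> a = b.
Proof. by rewrite /block; lia. Qed.

(** The condition shared by both counts: once the wires are contracted, relay [(k, f k)] ends where
    relay [(k.+1, f k.+1)] begins. *)
Definition wired (t : kind) (n : nat) (f : nat -> nat) : bool :=
  [forall k : 'I_n, block t k.+1 (f k) == block t k.+1 (f k.+1)].

Lemma wiredP t n f : reflect
  (forall k, (k < n)%N -> block t k.+1 (f k) = block t k.+1 (f k.+1))
  (wired t n f).
Proof.
apply: (iffP forallP) => [h k kn|h k]; last exact/eqP/h.
exact/eqP/(h (Ordinal kn)).
Qed.

Lemma eq_wired t n f g : (forall k, (k <= n)%N -> f k = g k) ->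
  wired t n f = wired t n g.
Proof.
by move=> e; apply: eq_forallb => k; rewrite !e // ltnW.
Qed.

Lemma wiredS t n f : wired t n.+1 f =
  wired t n f && (block t n.+1 (f n) == block t n.+1 (f n.+1)).
Proof.
apply/wiredP/andP => [h|[/wiredP h /eqP e] k].
  by split; [apply/wiredP => k kn; apply: h; lia|apply/eqP/h].
by rewrite ltnS leq_eqVlt => /orP[/eqP->|/h].
Qed.

(** * Brick-wall paths described by heights *)

Definition grid_point (i j : nat) : zpoint := (Posz i, Posz j).

(** The other member of the block of a point lies above it when the parity is the upward one and
    below it otherwise, exactly where the vertical step leads. *)
Lemma bw_step_grid t i j i' j' :
  bw_step t (grid_point i j) (grid_point i' j') =
    (i' == i.+1) && (j' == j)
    || [&& i' == i, j' != j & block t i j == block t i j'].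
Proof.
rewrite /bw_step /grid_point /block /= !xpair_eqE.
by case: t => /=; lia.
Qed.

(* The path enters column [k.+1] at height [f k] and leaves it at height
   [f k.+1]. *)
Fixpoint brick_tail (f : nat -> nat) (n : nat) : seq zpoint :=
  if n is k.+1 then
    brick_tail f k ++ grid_point k.+1 (f k) ::
      (if f k.+1 == f k then [::] else [:: grid_point k.+1 (f k.+1)])
  else [::].

Definition brick_path (f : nat -> nat) (n : nat) : seq zpoint :=
  grid_point 0 (f 0) :: brick_tail f n.

Lemma eq_brick_tail f g n : (forall k, (k <= n)%N -> f k = g k) ->
  brick_tail f n = brick_tail g n.
Proof.
elim: n => //= n IH e; rewrite IH => [|k kn]; last by apply: e; lia.
by rewrite !e.
Qed.

Lemma eq_brick_path f g n : (forall k, (k <= n)%N -> f k = g k) ->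
  brick_path f n = brick_path g n.
Proof. by move=> e; rewrite /brick_path (eq_brick_tail e) e. Qed.

Lemma last_brick_path f n :
  last (grid_point 0 (f 0)) (brick_tail f n) = grid_point n (f n).
Proof. by case: n => //= n; rewrite last_cat /=; case: eqP => [->|]. Qed.

Lemma brick_pathS f n : brick_path f n.+1 =
  brick_path f n ++ grid_point n.+1 (f n) ::
    (if f n.+1 == f n then [::] else [:: grid_point n.+1 (f n.+1)]).
Proof. by []. Qed.

Lemma mem_brick_path f n k : (k <= n)%N ->
  grid_point k (f k) \in brick_path f n.
Proof.
elim: n => [|n IH]; first by rewrite leqn0 => /eqP->; rewrite mem_head.
rewrite brick_pathS mem_cat leq_eqVlt ltnS => /orP[/eqP->|/IH->//].
by case: eqP => [->|_]; rewrite !inE eqxx ?orbT.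
Qed.

Lemma brick_path_mem f n x : x \in brick_path f n ->
  exists i, exists2 j, x = grid_point i (f j) & (i <= n)%N /\ (j <= n)%N.
Proof.
elim: n x => [|n IH] x; first by rewrite inE => /eqP->; exists 0%N; exists 0%N.
rewrite brick_pathS mem_cat => /orP[/IH[i [j -> [hi hj]]]|].
  by exists i; exists j => //; lia.
rewrite inE => /orP[/eqP->|]; first by exists n.+1; exists n.
by case: eqP; rewrite // inE => _ /eqP->; exists n.+1; exists n.+1.
Qed.

Lemma uniq_brick_path f n : uniq (brick_path f n).
Proof.
elim: n => // n IH; rewrite brick_pathS cat_uniq IH /=.
have nin j : grid_point n.+1 j \notin brick_path f n.
  by apply/negP => /brick_path_mem[i [m [<- _] []]]; rewrite ltnn.
rewrite (negbTE (nin _)) /=.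
by case: eqP => //= ne; rewrite (negbTE (nin _)) /= inE xpair_eqE eqxx; lia.
Qed.

Lemma path_brick_tail t f n : wired t n f ->
  path (bw_step t) (grid_point 0 (f 0)) (brick_tail f n).
Proof.
elim: n => // n IH; rewrite wiredS => /andP[/IH p e] /=.
rewrite cat_path p last_brick_path /= bw_step_grid !eqxx /=.
by case: eqP => //= /eqP ne; rewrite bw_step_grid eqxx e ne orbT.
Qed.

Lemma no_left_vertical_brick_path f n : no_left_vertical (brick_path f n).
Proof.
rewrite /no_left_vertical /=; elim: n => //= n IH.
rewrite cat_path IH last_brick_path /= andbF /=.
by case: eqP.
Qed.

Lemma brick_path_inj f g n : brick_path f n = brick_path g n ->
  forall k, (k <= n)%N -> f k = g k.
Proof.
elim: n => [[e] k|n IH e k]; first by rewrite leqn0 => /eqP->.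
have eqS : f n.+1 = g n.+1.
  have lp u : last (0, 0) (brick_path u n.+1) = grid_point n.+1 (u n.+1).
    exact: last_brick_path.
  by have := congr1 (last (0, 0)) e; rewrite !lp => -[].
rewrite leq_eqVlt ltnS => /orP[/eqP-> //|]; move: k; apply: IH.
(* The shorter path is recovered as the points of abscissa at most [n], so the induction hypothesis
   applies. *)
have h u : [seq x <- brick_path u n.+1 | x.1 < n.+1%:Z] = brick_path u n.
  rewrite brick_pathS filter_cat [X in _ ++ X](_ : _ = [::]) ?cats0; last first.
    by rewrite /= ltxx; case: eqP => //= _; rewrite ltxx.
  apply/all_filterP/allP => x /brick_path_mem[i [j -> []]].
  by rewrite ltz_nat ltnS.
by rewrite -h e h.
Qed.

(** Induction on the last point: a horizontal step opens a column, and a vertical one alters the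
    last height, provided its column had no vertical step yet. *)
Lemma brick_path_surj t a s :
    path (bw_step t) (grid_point 0 a) s -> uniq (grid_point 0 a :: s) ->
    no_left_vertical (grid_point 0 a :: s) ->
    all (fun x : zpoint => (0 <= x.1) && (0 <= x.2)) s ->
  exists n f, wired t n f /\ grid_point 0 a :: s = brick_path f n.
Proof.
rewrite /no_left_vertical /sorted.
elim/last_ind: s => [|s x IH].
  by move=> *; exists 0%N; exists (fun=> a); split=> //; apply/wiredP.
rewrite !rcons_path all_rcons -rcons_cons.
move=> /andP[p st]; rewrite rcons_uniq => /andP[xs u] /andP[q nv].
case/andP=> /andP[x1 x2] pos.
have [n [f [wf es]]] := IH p u q pos.
have ls : last (grid_point 0 a) s = grid_point n (f n).
  by case: es => -> ->; rewrite last_brick_path.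
rewrite ls in st nv.
have [i [j ex]] : exists i j, x = grid_point i j.
  by case: (x) x1 x2 => -[i|//] [j|//] _ _; exists i; exists j.
rewrite {}ex in st nv xs *.
move: st; rewrite bw_step_grid => /orP[/andP[/eqP ei /eqP ej]|].
  subst i j.
  exists n.+1; exists (fun k => if (k <= n)%N then f k else f n).
  have ef k : (k <= n)%N -> (if (k <= n)%N then f k else f n) = f k by move->.
  rewrite wiredS (eq_wired _ ef) wf ltnn leqnn eqxx; split=> //.
  by rewrite brick_pathS (eq_brick_path ef) ltnn leqnn eqxx es cats1.
case/and3P=> /eqP ei ne eb; rewrite {}ei in nv xs *.
(* A vertical step in column 0 contradicts [no_left_vertical]. *)
case: n => [|n] in wf es ls nv xs ne eb *; first by rewrite eqxx in nv.
move: wf; rewrite wiredS => /andP[wf ew].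
(* After an earlier vertical step in this column, the new one would return to the entry point
   [(n.+1, f n)], against uniqueness. *)
have [ef|/eqP nf] := eqVneq (f n.+1) (f n); last first.
  have e : j = f n.
    apply: block_pair (esym (eqP eb)) (eqP ew) _ _; first exact/eqP.
    exact/nesym.
  by case/negP: xs; rewrite es e brick_pathS mem_cat mem_head orbT.
exists n.+1; exists (fun k => if (k <= n)%N then f k else j).
have eg k : (k <= n)%N -> (if (k <= n)%N then f k else j) = f k by move->.
rewrite wiredS (eq_wired _ eg) wf ltnn leqnn -ef eb; split=> //.
rewrite brick_pathS (eq_brick_path eg) ltnn leqnn -ef (negbTE ne).
by rewrite es brick_pathS ef eqxx -cats1 -catA.
Qed.

(** * Cuts of the network *)

(** If no relay of [A] crossed the cut, [P] would be invariant under conduction and pass from the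
    source to the terminus. *)
Lemma network_closed_cut t l w (A : {set relay l w}) (P : pred (vertex l w)) :
    network_closed t A ->
    (forall u v, wire t u v -> P u = P v) ->
    P (source l w) -> ~~ P (terminus l w) ->
  exists2 c, c \in A & P (left_end c) != P (right_end c).
Proof.
move=> hA hP hS hT; apply/exists_inP; rewrite -[[exists _ in _, _]]negbK.
apply/negP => /exists_inPn h; case/negP: hT.
suff cl : closed (conducts t A) P.
  by have := closed_connect cl hA; rewrite -!topredE /= hS => <-.
move=> u v; rewrite -!topredE /= => /or3P[/hP//|/hP//|/exists_inP[c /h]].
by rewrite negbK => /eqP e /orP[]/andP[/eqP-> /eqP->].
Qed.

(** Source and terminus get levels 0 and [l] so that every relay of column i joins level i to level
    i + 1. *)
Definition level (l w : nat) (v : vertex l w) : nat :=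
  match v with inl b => if b then l else 0%N | inr c => c.1 end.

Lemma level_left_end l w (c : relay l w) : level (left_end c) = c.1.
Proof. by rewrite /left_end; case: eqP => //= ->. Qed.

Lemma level_right_end l w (c : relay l w) : level (right_end c) = (c.1).+1.
Proof.
rewrite /right_end; case: insubP => [i _ //|/=].
by have := ltn_ord c.1; lia.
Qed.

Lemma level_wire t l w (u v : vertex l w) : wire t u v -> level u = level v.
Proof. by case: u v => [//|[i j]] [//|[i' j']] /and4P[_ /eqP->]. Qed.

Lemma network_closed_column t l w (A : {set relay l w}) (i : 'I_l) :
  network_closed t A -> exists j, (i, j) \in A.
Proof.
move=> hA.
have := @network_closed_cut t l w A (fun v => (level v <= i)%N) hA.
case=> [u v /level_wire-> //|//||[k j] kj].
  by rewrite -ltnNge /=.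
rewrite level_left_end level_right_end /= => ne; exists j.
by have <- : k = i by apply: val_inj; move: ne => /=; lia.
Qed.

Definition graph (n w : nat) (f : {ffun 'I_n -> 'I_w}) : {set relay n w} :=
  [set (i, f i) | i : 'I_n].

Lemma mem_graph n w (f : {ffun 'I_n -> 'I_w}) i j :
  ((i, j) \in graph f) = (j == f i).
Proof.
by apply/imsetP/eqP => [[k _ [-> ->]]|->]; last by exists i.
Qed.

Lemma card_graph n w (f : {ffun 'I_n -> 'I_w}) : #|graph f| = n.
Proof. by rewrite card_imset ?card_ord // => i j []. Qed.

Lemma graph_inj n w : injective (@graph n w).
Proof.
move=> f g e; apply/ffunP => i; apply/eqP.
by rewrite -mem_graph -e mem_graph.
Qed.

Lemma network_closed_graph t l w (A : {set relay l w}) :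
  network_closed t A -> exists2 f, graph f \subset A & (l <= #|A|)%N.
Proof.
move=> hA; have ex i := network_closed_column i hA.
pose f := [ffun i => xchoose (ex i)].
have sub : graph f \subset A.
  apply/fintype.subsetP => -[i j]; rewrite mem_graph ffunE => /eqP->.
  exact: (xchooseP (ex i)).
by exists f => //; have := subset_leq_card sub; rewrite card_graph.
Qed.

(** * Closed sets with one relay per column *)

(** Beyond [n], [inord] gives a default value, which neither [wired t n] nor [brick_path _ n]
    reads. *)
Definition height (n w : nat) (f : {ffun 'I_n.+1 -> 'I_w}) (k : nat) : nat :=
  f (inord k).

Lemma height_ord n w (f : {ffun 'I_n.+1 -> 'I_w}) (i : 'I_n.+1) :
  height f i = f i.
Proof. by rewrite /height inord_val. Qed.

Lemma graph_closed_wired t n w (f : {ffun 'I_n.+1 -> 'I_w}) :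
  network_closed t (graph f) -> wired t n (height f).
Proof.
move=> hA; apply/wiredP => k kn; apply/eqP; apply: contraT => ne.
(* The cut consists of the levels up to [k] and the block in column [k.+1] that relay [k] reaches.
   Relay [k] stays inside it, and by [ne] relay [k.+1] starts outside it. *)
pose P (v : vertex n.+1 w) := (level v <= k)%N || if v is inr (i, j)
  then (i == k.+1 :> nat) && (block t k.+1 (height f k) == block t k.+1 j)
  else false.
have hP u v : wire t u v -> P u = P v.
  case: u v => [//|[i j]] [//|[i' j']] /and4P[_ /eqP-> /eqP ej up].
  rewrite /P /= ej; congr orb; case: eqP => //= ei.
  by rewrite -ei (block_wire up).
have [||[i j]] := network_closed_cut hA hP; first by [].
  by rewrite /P /= orbF; lia.
rewrite mem_graph => /eqP-> {j}; case/eqP.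
rewrite /P level_left_end level_right_end /=.
have -> : (if left_end (i, f i) is inr (i0, j) then (i0 == k.+1 :> nat) &&
    (block t k.+1 (height f k) == block t k.+1 j) else false) = false.
  rewrite /left_end; case: ifP => //= _; case: eqP => //= ei.
  by rewrite -height_ord ei (negbTE ne).
rewrite orbF /right_end /=; case: insubP => [i1 _ /= ei|/=]; last by lia.
rewrite ei eqSS; case: (ltngtP i k) => //= e.
by rewrite -e height_ord eqxx.
Qed.

Lemma wired_graph_closed t n w (f : {ffun 'I_n.+1 -> 'I_w}) :
  wired t n (height f) -> network_closed t (graph f).
Proof.
move/wiredP => wf.
have relay_conducts i :
    conducts t (graph f) (left_end (i, f i)) (right_end (i, f i)).
  apply/or3P/Or33/exists_inP; exists (i, f i); first by rewrite mem_graph.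
  by rewrite !eqxx.
suff reach k (kn : (k < n.+1)%N) : connect (conducts t (graph f))
    (source _ _) (left_end (inord k, f (inord k))).
  apply: connect_trans (reach n (ltnSn n)) (connect1 _).
  have := relay_conducts (inord n).
  by rewrite /right_end /= insubF ?inordK // ltnn.
elim: k kn => [|k IH] kn; first by rewrite /left_end /= inordK.
apply: connect_trans (IH (ltnW kn)) _.
apply: connect_trans (connect1 (relay_conducts _)) _.
rewrite /left_end /right_end /= !inordK // ?(ltnW kn) //=.
case: insubP => [i _ ei|]; last by rewrite kn.
have -> : i = inord k.+1 by apply: val_inj; rewrite /= ei inordK.
(* Two nodes of one block are equal or joined by a wire, in one of the two orders. *)
have := wf k kn => /eqP/block_eqP; rewrite /height => h.
have [e|ne] := eqVneq (f (inord k)) (f (inord k.+1)); first by rewrite e.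
apply: connect1; rewrite /conducts /= !inordK // eqxx /=.
by case: h => [/val_inj/eqP|[-> ->]|[-> ->]]; rewrite ?(negbTE ne) ?eqxx ?orbT.
Qed.

Lemma network_closedE t n w (f : {ffun 'I_n.+1 -> 'I_w}) :
  network_closed t (graph f) = wired t n (height f).
Proof.
by apply/idP/idP; [exact: graph_closed_wired|exact: wired_graph_closed].
Qed.

(** * Both counts as numbers of wired height functions *)

Lemma closed_count_wired t n w : closed_count t n.+1 w n.+1 =
  #|[pred f : {ffun 'I_n.+1 -> 'I_w} | wired t n (height f)]|.
Proof.
rewrite -(card_imset _ (@graph_inj n.+1 w)); apply: eq_card => A.
rewrite inE; apply/andP/imsetP => [[/eqP cA hA]|[f]].
  have [f sub _] := network_closed_graph hA.
  (* The graph inside [A] already has [n.+1] elements, so it exhausts [A]. *)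
  have e : graph f = A by apply/eqP; rewrite eqEcard sub card_graph cA /=.
  by exists f => //; rewrite inE -network_closedE e.
by rewrite inE => wf ->; rewrite card_graph network_closedE.
Qed.

Lemma brick_path_crossing t n w (f : {ffun 'I_n.+1 -> 'I_w}) :
  wired t n (height f) -> crossing_paths t n.+1 w (brick_path (height f) n).
Proof.
move=> wf; apply/and5P; split=> //.
- apply/and3P; split=> //; last exact: uniq_brick_path.
  exact: path_brick_tail.
- apply/allP => x /brick_path_mem[i [j -> [hi _]]].
  by rewrite /in_rectangle /=; have := ltn_ord (f (inord j)); rewrite /height; lia.
- exact: no_left_vertical_brick_path.
- by rewrite /= last_brick_path /=; lia.
Qed.

Lemma crossing_brick_path t n w s : crossing_paths t n.+1 w s ->
  exists2 f : {ffun 'I_n.+1 -> 'I_w},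
    wired t n (height f) & s = brick_path (height f) n.
Proof.
case: s => [|x s]; first by case/and5P.
case/and5P=> /and3P[_ p u] r nv /= x0 ls.
have [a ex] : exists a, x = grid_point 0 a.
  case/andP: r => /andP[_ /andP[]]; move: x0; case: (x) => i [a|//] /= /eqP-> _ _.
  by exists a.
subst x.
have pos : all (fun y : zpoint => (0 <= y.1) && (0 <= y.2)) s.
  by case/andP: r => _; apply: sub_all => y /andP[/andP[-> _] /andP[->]].
have [m [f [wf es]]] := brick_path_surj p u nv pos.
have em : m = n.
  by move: ls; case: es => -> ->; rewrite last_brick_path /=; lia.
subst m; rewrite es in r *.
have fw k : (k <= n)%N -> (f k < w)%N.
  by move/(@mem_brick_path f) => /(allP r) /andP[_] /=; lia.
(* [inord] needs a nonempty codomain; [w = 0] is impossible since the path has a point in the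
   rectangle. *)
case: w => [|w] in r fw *; first by have := fw 0%N isT.
pose g : {ffun 'I_n.+1 -> 'I_w.+1} := [ffun i : 'I_n.+1 => inord (f i)].
have eg k : (k <= n)%N -> f k = height g k.
  by move=> kn; rewrite /height ffunE !inordK ?fw.
by exists g; rewrite -?(eq_wired _ eg) -?(eq_brick_path eg).
Qed.

(** An explicit finite set gives both finiteness and the value of [fset_set] in [bw_count]. *)
Lemma crossing_paths_fset t n w : crossing_paths t n.+1 w =
  [set` [fset s in [seq brick_path (height f) n |
    f in [pred f : {ffun 'I_n.+1 -> 'I_w} | wired t n (height f)]]]%fset]%classic.
Proof.
apply/seteqP; split=> s /=; rewrite in_fset /=.
  case/crossing_brick_path=> f wf ->.
  by apply/fintype.imageP; exists f; rewrite ?inE.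
by case/fintype.imageP=> f; rewrite inE => /brick_path_crossing h ->.
Qed.

Lemma brick_path_height_inj n w :
  injective (fun f : {ffun 'I_n.+1 -> 'I_w} => brick_path (height f) n).
Proof.
move=> f g /brick_path_inj h; apply/ffunP => i; apply: val_inj => /=.
by have := h i (leq_ord i); rewrite !height_ord.
Qed.

Lemma bw_count_wired t n w : bw_count t n.+1 w =
  #|[pred f : {ffun 'I_n.+1 -> 'I_w} | wired t n (height f)]|.
Proof.
rewrite /bw_count crossing_paths_fset set_fsetK card_fseq undup_id.
  by rewrite size_image.
by rewrite map_inj_uniq ?enum_uniq //; exact: brick_path_height_inj.
Qed.

(** * Coefficients of the reliability polynomial *)

Lemma closed_count_lt t l w k : (k < l)%N -> closed_count t l w k = 0%N.
Proof.
move=> kl; apply/eqP; rewrite cards_eq0; apply/eqP/setP => A; rewrite !inE.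
apply/negP => /andP[/eqP cA /network_closed_graph[_ _]].
by rewrite cA leqNgt kl.
Qed.

(* For [m < l] both sides vanish. *)
Lemma sum_ord_drop (V : nmodType) (F : nat -> V) l m :
  (forall k, (k < l)%N -> F k = 0) ->
  \sum_(k < m) F k = \sum_(l <= k < m) F k.
Proof.
move=> F0; rewrite [RHS](big_nat_widenl l 0) // big_mkord [RHS]big_mkcond /=.
by apply: eq_bigr => k _; case: leqP => // /F0.
Qed.

Lemma closed_probE (R : comNzRingType) t l w (p : R) : closed_prob t l w p =
  \sum_(l <= k < (w * l).+1)
     (closed_count t l w k)%:R * (p ^+ k * (1 - p) ^+ (w * l - k)).
Proof.
have card_relay : #|{: relay l w}| = (w * l)%N by rewrite card_prod !card_ord mulnC.
have cardA (A : {set relay l w}) : (#|A| < (w * l).+1)%N.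
  by rewrite ltnS -card_relay max_card.
transitivity (\sum_(A : {set relay l w} | network_closed t A)
    p ^+ #|A| * (1 - p) ^+ (w * l - #|A|)).
  apply: eq_bigr => A _; rewrite (bigID (mem A)) /=; congr (_ * _).
    by rewrite -prodr_const; apply: eq_bigr => c ->.
  rewrite -card_relay -(cardC (mem A)) addKn -prodr_const.
  by apply: eq_big => c; rewrite ?inE // => /negbTE->.
(* The weight of [A] depends only on its cardinality, by which the sum is now grouped. *)
rewrite (partition_big (fun A => Ordinal (cardA A)) predT) //=.
transitivity (\sum_(k < (w * l).+1)
    (closed_count t l w k)%:R * (p ^+ k * (1 - p) ^+ (w * l - k))).
  apply: eq_bigr => k _; rewrite mulr_natl /closed_count -sumr_const.
  apply: eq_big => A; first by rewrite inE andbC.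
  by case/andP=> _ /eqP<-.
apply: sum_ord_drop => k kl.
by rewrite closed_count_lt // mul0r.
Qed.

Lemma horner_reliability_poly (R : comNzRingType) t l w (p : R) :
  (reliability_poly R t l w).[p] = closed_prob t l w p.
Proof.
rewrite horner_sum; apply: eq_bigr => A _; rewrite horner_prod.
by apply: eq_bigr => c _; case: ifP; rewrite !hornerE.
Qed.

(** This is [closed_probE] at the indeterminate; the factor ['X^k] shifts coefficients by [k]. *)
Lemma coef_reliability_poly (R : comNzRingType) t l w i :
  (reliability_poly R t l w)`_i = \sum_(l <= k < (w * l).+1)
    (closed_count t l w k)%:R *
    (if (i < k)%N then 0 else ((1 - 'X) ^+ (w * l - k) : {poly R})`_(i - k)).
Proof.
rewrite /reliability_poly closed_probE coef_sum; apply: eq_bigr => k _.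
by rewrite mulr_natl coefMn coefXnM mulr_natl.
Qed.

Lemma coef_reliability_poly_lt (R : comNzRingType) t l w i : (i < l)%N ->
  (reliability_poly R t l w)`_i = 0.
Proof.
move=> il; rewrite coef_reliability_poly big_nat big1 // => k /andP[lk _].
by rewrite (leq_trans il lk) mulr0.
Qed.

Lemma coef_reliability_poly_first (R : comNzRingType) t l w : (0 < w)%N ->
  (reliability_poly R t l w)`_l = (closed_count t l w l)%:R.
Proof.
move=> w0; rewrite coef_reliability_poly big_ltn ?ltnS ?leq_pmull //.
rewrite big_nat big1 ?addr0 => [|k /andP[-> _]]; last by rewrite mulr0.
(* Only the term [k = l] is left, and the constant coefficient of a power of [1 - 'X] is its value 1
   at 0. *)
by rewrite ltnn subnn -horner_coef0 !hornerE subr0 expr1n mulr1.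
Qed.

Lemma size_reliability_poly (R : comNzRingType) t l w :
  (size (reliability_poly R t l w) <= (w * l).+1)%N.
Proof.
apply/leq_sizeP => i hi; rewrite coef_reliability_poly big_nat big1 // => k.
move=> /andP[_ kl]; case: ifP => ik; first by rewrite mulr0.
rewrite [X in _ * X](_ : _ = 0) ?mulr0 //.
have /leq_sizeP -> // : (size ((1 - 'X) ^+ (w * l - k) : {poly R}) <= (w * l - k).+1)%N.
  apply: leq_trans (size_poly_exp_leq _ _) _; rewrite ltnS.
  have : (size (1 - 'X : {poly R})%R <= 2)%N.
    by rewrite -opprB size_polyN -polyC1 size_XsubC.
  by move: (size _) => s; nia.
by lia.
Qed.

Theorem mainTheorem5 (R : realFieldType) (l w : nat) (t : kind)
    (hl : (2 <= l)%N) (hw : (2 <= w)%N) :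
  let h : {poly R} := reliability_poly R t l w in
  let N := closed_count t l w in
  let P := fun k : nat => h`_k in
  [/\ (forall p : R, 0 <= p <= 1 -> h.[p] = closed_prob t l w p),
      h = \sum_(l <= k < (w * l).+1) (N k)%:R *: ('X^k * (1 - 'X) ^+ (w * l - k)),
      h = \sum_(l <= k < (w * l).+1) P k *: 'X^k,
      finite_set (crossing_paths t l w)
    & P l = (N l)%:R /\ N l = bw_count t l w].
Proof.
case: l hl => [//|n] hl h N P; split.
- by move=> p _; exact: horner_reliability_poly.
- rewrite /h /reliability_poly closed_probE; apply: eq_bigr => k _.
  by rewrite scaler_nat mulr_natl.
(* Since the coefficients below [l] vanish, the sum may start at 0; the degree bound makes it the
   full expansion of [h]. *)
- rewrite -sum_ord_drop => [|k kn]; last first.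
    by rewrite /P coef_reliability_poly_lt // scale0r.
  rewrite -poly_def; apply/polyP => i.
  rewrite coef_poly; case: ltnP => // hi.
  exact: (leq_sizeP _ _ (size_reliability_poly R t n.+1 w)).
- by rewrite crossing_paths_fset; exact: finite_fset.
- split; first by apply: coef_reliability_poly_first; lia.
  by rewrite /N closed_count_wired bw_count_wired.
Qed.
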